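(* Let $Q(x,y)\in\mathbb{C}[x^{\pm1},y^{\pm1}]$ be a Laurent polynomial with no constant term, and for $r\in\mathbb{C}$ put $Q_r(x,y)=r-Q(x,y)$. Let $v_1$ (resp. $v_2$) be the largest power of $x^{-1}$ (resp. $y^{-1}$) occurring in $Q_r$, and write $$y^{v_2}Q_r(x,y)=Q^y_{F,r}(x)\,y^{d_y}+\sum_{j=1}^{d_y-1}a^y_{j,r}(x)y^j+Q^y_{f,r}(x),\qquad x^{v_1}Q_r(x,y)=Q^x_{F,r}(y)\,x^{d_x}+\sum_{j=1}^{d_x-1}a^x_{j,r}(y)x^j+Q^x_{f,r}(y),$$ with $Q^y_{F,r},Q^y_{f,r}$ (resp. $Q^x_{F,r},Q^x_{f,r}$) the leading and constant coefficients with respect to $y$ (resp. $x$). Let $a,b>0$, let $\mathcal{R}_{a,b}=\{Q(x,y):|x|=a,|y|=b\}$, let $r_0$ lie in a bounded connected component of $\mathbb{C}\setminus\mathcal{R}_{a,b}$, and let $V_{a,b,r_0}$ be that component. Define $\nu^1_{a,b,r}$ and $\nu^2_{a,b,r}$ as follows: $\nu^1_{a,b,r}$ is the number of zeros (with multiplicity) of $x\mapsto Q_r(x,b)$ in $0<|x|<a$ minus the order of the pole of $Q_r(x,b)$ at $x=0$; $\nu^2_{a,b,r}$ is the number of zeros (with multiplicity) of $y\mapsto Q_r(a,y)$ in $0<|y|<b$ minus the order of the pole of $Q_r(a,y)$ at $y=0$. (i) If the roots of $Q_{r_0}(a,y)$ (as a function of $y$) either all lie inside the circle $|y|=b$ or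 all lie outside it, then for all $r\in V_{a,b,r_0}$: $\mathrm{m}_{a,b}(Q_r)-\nu^2_{a,b,r}\log b=\mathrm{m}_a(Q^y_{F,r}(x))$ if all these roots lie inside $|y|=b$, and $\mathrm{m}_{a,b}(Q_r)-\nu^2_{a,b,r}\log b=\mathrm{m}_a(Q^y_{f,r}(x))$ if all lie outside. (ii) If the roots of $Q_{r_0}(x,b)$ (as a function of $x$) either all lie inside the circle $|x|=a$ or all lie outside it, then for all $r\in V_{a,b,r_0}$: $\mathrm{m}_{a,b}(Q_r)-\nu^1_{a,b,r}\log a=\mathrm{m}_b(Q^x_{F,r}(y))$ if all these roots lie inside $|x|=a$, and $\mathrm{m}_{a,b}(Q_r)-\nu^1_{a,b,r}\log a=\mathrm{m}_b(Q^x_{f,r}(y))$ if all lie outside.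
   Context: For a nonzero rational function $P\in\mathbb{C}(x_1,\dots,x_n)$ and $\mathfrak{a}=(a_1,\dots,a_n)\in\mathbb{R}_{>0}^n$, the generalized Mahler measure is $\mathrm{m}_{\mathfrak{a}}(P)=\frac{1}{(2\pi i)^n}\int_{\mathbb{T}^n_{\mathfrak{a}}}\log|P|\frac{dx_1}{x_1}\cdots\frac{dx_n}{x_n}$ with $\mathbb{T}^n_{\mathfrak{a}}=\{|x_j|=a_j\ \forall j\}$. Thus $\mathrm{m}_a(f(x))=\frac{1}{2\pi i}\int_{|x|=a}\log|f(x)|\frac{dx}{x}$ for one-variable $f$, and $\mathrm{m}_{a,b}$ is over $|x|=a,|y|=b$.
   Formalization: ''All roots inside'' also requires the leading coefficient at x=a (resp. y=b) to be nonzero, i.e. d_y (resp. d_x) roots; ''all outside'' requires the constant coefficient there to be nonzero; the literal claim fails, e.g. Q=y+e(x-1)y^2, a=b=1, small e and r_0. *)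

(* Defs.v *)
From mathcomp Require Import all_boot all_order all_algebra finmap.
From mathcomp Require Import all_classical all_reals all_analysis.
From mathcomp Require Import complex.

Set Implicit Arguments.
Unset Strict Implicit.
Unset Printing Implicit Defensive.

Import Order.TTheory GRing.Theory Num.Theory.
Import numFieldNormedType.Exports.
Import complex.ComplexField.

Local Open Scope classical_set_scope.
Local Open Scope complex_scope.
Local Open Scope ring_scope.

(* [P (i, j)] is the coefficient of x^i y^j. *)
Definition laurent2 (R : realType) := {fsfun int * int -> R[i] with 0}.

Section Laurent.
Variable R : realType.
Implicit Types (P Q : laurent2 R) (x y r : R[i]) (a b : R).

Definition leval P x y : R[i] :=
  \sum_(k <- finsupp P) P k * x ^ k.1 * y ^ k.2.

(* r - Q *)
Definition Qr Q r : laurent2 R :=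
  [fsfun k in ((0, 0) |` finsupp Q)%fset => (if k == (0, 0) then r else 0) - Q k].

(* Largest powers of x^-1, y^-1, x and y occurring in P, with value 0 when no
   such power occurs.  The term r - Q(0, 0) contributes 0 to each maximum, so
   for P = Qr Q r these numbers do not depend on r, not even when r = 0. *)
Definition xpole P : nat := \max_(k <- finsupp P | k.1 < 0) absz k.1.
Definition ypole P : nat := \max_(k <- finsupp P | k.2 < 0) absz k.2.
Definition xtop P : nat := \max_(k <- finsupp P | 0 < k.1) absz k.1.
Definition ytop P : nat := \max_(k <- finsupp P | 0 < k.2) absz k.2.

(* The degrees d_x of x^v1 P in x and d_y of y^v2 P in y. *)
Definition xdeg P : nat := (xtop P + xpole P)%N.
Definition ydeg P : nat := (ytop P + ypole P)%N.

(* y^v2 P(x, y) as a polynomial in y, and x^v1 P(x, y) as a polynomial in x;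
   the absolute values are taken of nonnegative integers. *)
Definition ypoly P x : {poly R[i]} :=
  \sum_(k <- finsupp P) (P k * x ^ k.1) *: 'X^(absz (k.2 + (ypole P)%:Z)).
Definition xpoly P y : {poly R[i]} :=
  \sum_(k <- finsupp P) (P k * y ^ k.2) *: 'X^(absz (k.1 + (xpole P)%:Z)).

(* Leading (F) and constant (f) coefficients in y, as functions of x, and in x,
   as functions of y. *)
Definition QFy P x : R[i] := (ypoly P x)`_(ydeg P).
Definition Qfy P x : R[i] := (ypoly P x)`_0.
Definition QFx P y : R[i] := (xpoly P y)`_(xdeg P).
Definition Qfx P y : R[i] := (xpoly P y)`_0.

(* The roots of a nonzero polynomial, repeated according to multiplicity. *)
Definition proots (p : {poly R[i]}) : seq R[i] :=
  sval (closed_field_poly_normal p).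

(* The polynomial p is a specialization, at one value of the other variable, of
   a polynomial of degree d with variable coefficients, and "its roots" are the
   d roots of that family: when the leading coefficient vanishes at the chosen
   value, the missing roots are at infinity, hence outside every circle.  A root
   at 0 lies inside. *)
Definition roots_inside (d : nat) (p : {poly R[i]}) b : Prop :=
  size (proots p) = d /\ forall z, z \in proots p -> Normc.normc z < b.
Definition roots_outside (p : {poly R[i]}) b : Prop :=
  forall z, z \in proots p -> b < Normc.normc z.

(* For f(z) = z^-v p(z): the number of zeros of f in 0 < |z| < b, and the order
   of the pole of f at 0, which is - m when f has a zero of order m at 0. *)
Definition nzeros (p : {poly R[i]}) b : nat :=
  count (fun z => (0 < Normc.normc z) && (Normc.normc z < b)) (proots p).
Definition pole_order (v : nat) (p : {poly R[i]}) : int :=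
  v%:Z - (mup 0 p)%:Z.

Definition nu1 a b P : int :=
  (nzeros (xpoly P b%:C) a)%:Z - pole_order (xpole P) (xpoly P b%:C).
Definition nu2 a b P : int :=
  (nzeros (ypoly P a%:C) b)%:Z - pole_order (ypole P) (ypoly P a%:C).

Definition circle_pt a (t : R) : R[i] := a%:C * (cos t +i* sin t).

(* With x = a e^(it), the form dx / (2 pi i x) becomes dt / (2 pi). *)
Definition mahler1 a (f : R[i] -> R[i]) : R :=
  (2 * pi)^-1 *
  \int[lebesgue_measure]_(t in `[0, 2 * pi]) ln (Normc.normc (f (circle_pt a t))).

Definition mahler2 a b (f : R[i] -> R[i] -> R[i]) : R :=
  (2 * pi) ^- 2 *
  \int[(@lebesgue_measure R \x @lebesgue_measure R)%E]_(t in `[0, 2 * pi] `*` `[0, 2 * pi])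
     ln (Normc.normc (f (circle_pt a t.1) (circle_pt b t.2))).

Definition Rab Q a b : set R[i]^o :=
  [set w | exists x y, [/\ Normc.normc x = a, Normc.normc y = b & w = leval Q x y]].

Definition Vab Q a b r0 : set R[i]^o := connected_component (~` Rab Q a b) r0.

End Laurent.

(* Main.v *)
(* For r in the component V and |x| = a, the polynomial p(y) = y^v Q_r(x, y) has no zero on |y| = b.
   Its coefficients depend continuously on r and x, and V and the circle are connected, so "no zero
   in |y| <= b" propagates from one pair (r, x) to all pairs; the reversed polynomial y^d p(1/y) does
   the same for "all d zeros in |y| < b".  Jensen's formula then evaluates the inner integral as
   log|Qf(x)|, respectively log|QF(x)| + d log b, and Fubini's theorem concludes.

   Jensen's formula: for J(s) = int log|prod_(z in s) (1 - z e^it)| dt with all |z| <= q < 1, the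
   identity 1 - z^2 w^2 = (1 - z w)(1 + z w) gives J(s^2) = 2 J(s), where s^2 squares the elements
   of s.  As J stays bounded under iterated squaring, J(s) = 0. *)

Require Import Defs.
From mathcomp Require Import all_boot all_order all_algebra finmap.
From mathcomp Require Import all_classical all_reals all_analysis.
From mathcomp Require Import measurable_realfun complex ring lra zify.
Import Order.TTheory GRing.Theory Num.Theory.
Import numFieldNormedType.Exports.
Local Open Scope classical_set_scope.
Local Open Scope complex_scope.
Local Open Scope ring_scope.

Set Implicit Arguments.
Unset Strict Implicit.
Unset Printing Implicit Defensive.

Import ComplexField.
Import Normc.

(** * Complex modulus, and the roots of a polynomial relative to a closed disk *)

Section NormC.
Variable R : realType.
Implicit Types (x y z : R[i]) (p : {poly R[i]}) (b : R).

Lemma normcR z : `|z| = (normc z)%:C. Proof. by []. Qed.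

Lemma normc_ge0 z : 0 <= normc z.
Proof. by rewrite -lecR -normcR normr_ge0. Qed.

Lemma normc_eq0 z : (normc z == 0) = (z == 0).
Proof.
by apply/eqP/eqP => [/eq0_normc //|->]; rewrite normc0.
Qed.

Lemma normc_gt0 z : (0 < normc z) = (z != 0).
Proof. by rewrite lt_def normc_ge0 normc_eq0 andbT. Qed.

Lemma normcX z n : normc (z ^+ n) = normc z ^+ n.
Proof. by elim: n => [|n IH]; rewrite ?expr0 ?normc1// !exprS normcM IH. Qed.

Lemma normc_opp z : normc (- z) = normc z. Proof. exact: normcN. Qed.

Lemma normcB x y : normc (x - y) = normc (y - x).
Proof. by rewrite -normc_opp opprB. Qed.

Lemma ler_normcD x y : normc (x + y) <= normc x + normc y.
Proof. exact: le_normcD. Qed.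

Lemma ler_normcB x y : normc x - normc y <= normc (x - y).
Proof. by rewrite lerBlDr -{1}(subrK y x) ler_normcD. Qed.

Lemma normc_prod (I : Type) (s : seq I) (F : I -> R[i]) :
  normc (\prod_(i <- s) F i) = \prod_(i <- s) normc (F i).
Proof.
by elim: s => [|i s IH]; rewrite ?big_nil ?normc1// !big_cons normcM IH.
Qed.

Lemma ler_normc_sum (I : Type) (s : seq I) (F : I -> R[i]) :
  normc (\sum_(i <- s) F i) <= \sum_(i <- s) normc (F i).
Proof.
elim: s => [|i s IH]; rewrite ?big_nil ?normc0// !big_cons.
by rewrite (le_trans (ler_normcD _ _))// lerD2l.
Qed.

Lemma normc_real b : 0 <= b -> normc b%:C = b.
Proof. by move=> b0; rewrite /normc /= expr0n addr0 sqrtr_sqr ger0_norm. Qed.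

Lemma normc_conj z : normc z^*%C = normc z.
Proof. by case: z => x y; rewrite /normc /= sqrrN. Qed.

Lemma prootsE p : p = lead_coef p *: \prod_(z <- proots p) ('X - z%:P).
Proof. exact: (svalP (closed_field_poly_normal p)). Qed.

Lemma size_proots p : p != 0 -> size p = (size (proots p)).+1.
Proof.
move=> p0; rewrite {1}(prootsE p) size_scale ?lead_coef_eq0//.
by rewrite size_prod_XsubC.
Qed.

Lemma horner_proots p y :
  p.[y] = lead_coef p * \prod_(z <- proots p) (y - z).
Proof.
rewrite {1}(prootsE p) hornerZ horner_prod.
by congr (_ * _); apply: eq_bigr => z _; rewrite hornerXsubC.
Qed.

Lemma normc_horner p y :
  normc p.[y] = normc (lead_coef p) * \prod_(z <- proots p) normc (y - z).
Proof. by rewrite horner_proots normcM normc_prod. Qed.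

Lemma mem_proots p z : p != 0 -> (z \in proots p) = (p.[z] == 0).
Proof.
move=> p0; rewrite horner_proots mulf_eq0 lead_coef_eq0 (negbTE p0)/=.
rewrite prodf_seq_eq0; apply/idP/hasP => [zp|[w wp /=]].
  by exists z => //=; rewrite subrr.
by rewrite subr_eq0 => /eqP->.
Qed.

Lemma mup_proots p z : p != 0 -> mup z p = count_mem z (proots p).
Proof.
move=> p0; rewrite {1}(prootsE p) -mul_polyC mupMr ?mu_prod_XsubC//.
by rewrite rootC lead_coef_eq0.
Qed.

(** Taken on the closed disk, the condition yields a positive lower bound there, hence survives
    small perturbations of the coefficients in bounded degree. *)
Definition disk_free b p := forall y, normc y <= b -> p.[y] != 0.

Lemma disk_free_neq0 b p : 0 <= b -> disk_free b p -> p != 0.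
Proof.
move=> b0 /(_ 0); rewrite normc0 => /(_ b0).
by apply: contraNneq => ->; rewrite horner0.
Qed.

Lemma disk_free_roots b p : 0 <= b -> disk_free b p ->
  forall z, z \in proots p -> b < normc z.
Proof.
move=> b0 pb z; rewrite mem_proots ?(disk_free_neq0 b0 pb)// => pz.
by rewrite ltNge; apply: contraL pz => /pb.
Qed.

Lemma roots_disk_free b p : p != 0 -> roots_outside p b -> disk_free b p.
Proof.
move=> p0 pb y yb; rewrite -mem_proots//; apply/negP => /pb.
by rewrite ltNge yb.
Qed.

(** Every factor [normc (y - z)] is at least [normc z - b], which is positive because the roots lie
    outside the closed disk. *)
Lemma disk_free_lb b p : 0 <= b -> disk_free b p ->
  exists2 k : R, 0 < k & forall y, normc y <= b -> k <= normc p.[y].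
Proof.
move=> b0 pb; have p0 := disk_free_neq0 b0 pb.
have rb := disk_free_roots b0 pb.
exists (normc (lead_coef p) * \prod_(z <- proots p) (normc z - b)).
  rewrite mulr_gt0 ?normc_gt0 ?lead_coef_eq0// big_seq prodr_gt0// => z zp.
  by rewrite subr_gt0 rb.
move=> y yb; rewrite normc_horner ler_wpM2l ?normc_ge0//.
rewrite big_seq [leRHS]big_seq ler_prod// => z zp.
rewrite subr_ge0 ltW ?rb//= normcB (le_trans _ (ler_normcB _ _))//.
by rewrite lerD2l lerN2.
Qed.

(** For a root [z], [normc (y0 - z)] is at least [b - normc y0] while [normc (y1 - y0)] is at most
    [2 * b], so each of the at most [d] factors grows by no more than [1 + 2 * b / (b - normc y0)].
    The constant does not depend on [p]. *)
Lemma disk_free_ratio b d p y0 y1 : 0 <= b -> disk_free b p ->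
  (size p <= d.+1)%N -> normc y0 < b -> normc y1 <= b ->
  normc p.[y1] <= (1 + 2 * b / (b - normc y0)) ^+ d * normc p.[y0].
Proof.
move=> b0 pb sp y0b y1b; have p0 := disk_free_neq0 b0 pb.
have rb := disk_free_roots b0 pb.
set K := 1 + _.
have by0 : 0 < b - normc y0 by rewrite subr_gt0.
have K1 : 1 <= K by rewrite lerDl divr_ge0 ?ltW// mulr_gt0// (le_lt_trans _ y0b) ?normc_ge0.
have K0 : 0 <= K by rewrite (le_trans _ K1).
have sd : (size (proots p) <= d)%N by rewrite -ltnS -size_proots.
rewrite !normc_horner mulrCA ler_wpM2l ?normc_ge0//.
have h0 : 0 <= \prod_(z <- proots p) normc (y0 - z).
  by rewrite prodr_ge0// => z _; rewrite normc_ge0.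
(* As [K >= 1], one factor [K] per actual root suffices, even when the degree is below [d]. *)
apply: (@le_trans _ _ (K ^+ size (proots p) * \prod_(z <- proots p) normc (y0 - z))); last first.
  by rewrite ler_wpM2r// ler_weXn2l.
have -> : K ^+ size (proots p) = \prod_(z <- proots p) K.
  by rewrite big_const_seq count_predT iter_mulr_1.
rewrite -big_split /= big_seq [leRHS]big_seq ler_prod// => z zp.
rewrite normc_ge0/=.
have h1 : b - normc y0 <= normc (y0 - z).
  by rewrite normcB (le_trans _ (ler_normcB _ _))// lerD2r ltW// rb.
rewrite (_ : y1 - z = (y0 - z) + (y1 - y0)); last by ring.
rewrite (le_trans (ler_normcD _ _))// mulrDl mul1r lerD2l.
apply: (@le_trans _ _ (2 * b)).
  by rewrite (le_trans (ler_normcD _ _))// normc_opp; lra.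
by rewrite -mulrAC ler_pdivlMr// ler_wpM2l// mulr_ge0.
Qed.

End NormC.

(** * Propagation of zero-free disks along connected families of polynomials *)

Section DiskFree.
Variable R : realType.
Implicit Types (x y z : R[i]) (p : {poly R[i]}) (b : R).

Lemma connected_clopen_ind (T : topologicalType) (A S : set T) : connected A ->
  (forall t, A t -> S t -> \forall s \near t, A s -> S s) ->
  (forall t, A t -> ~ S t -> \forall s \near t, A s -> ~ S s) ->
  forall t0 t, A t0 -> S t0 -> A t -> S t.
Proof.
move=> cA oS cS t0 t At0 St0 At.
suff : A `&` S = A by move=> /seteqP[_ /(_ t At)[]].
apply: cA; first by exists t0.
(* The hypotheses are local within [A]. Interiors of implications turn them into an open set of [T],
   and then a closed one, whose traces on [A] are both the intersection of [A] and [S]. *)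
- exists (interior [set s | A s -> S s]); first exact: open_interior.
  apply/seteqP; split=> s [As Ss]; split=> //; first exact: oS.
  exact: (nbhs_singleton Ss).
- exists (~` interior [set s | A s -> ~ S s]).
    exact/open_closedC/open_interior.
  apply/seteqP; split=> s [As Ss]; split=> //.
    by move=> /nbhs_singleton /(_ As).
  by apply: contrapT => nSs; apply: Ss; exact: cS.
Qed.

Section Family.
Variables (T : topologicalType) (P : T -> {poly R[i]}) (d : nat) (b : R).
Hypothesis b0 : 0 < b.
Hypothesis sp : forall t, (size (P t) <= d.+1)%N.
Hypothesis cp : forall t j (e : R), 0 < e ->
  \forall s \near t, normc ((P s)`_j - (P t)`_j) < e.

Lemma horner_near t (e : R) : 0 < e ->
  \forall s \near t, forall y, normc y <= b ->
    normc ((P s).[y] - (P t).[y]) < e.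
Proof.
(* The summand 1 makes [K] positive and strictly larger than the sum, which gives the strict
   inequality at the end. *)
move=> e0; pose K := 1 + \sum_(j < d.+1) b ^+ j.
have K0 : 0 < K by rewrite ltr_wpDr// sumr_ge0// => j _; rewrite exprn_ge0// ltW.
have : \forall s \near t, forall j : 'I_d.+1,
    normc ((P s)`_j - (P t)`_j) < e / K.
  by apply: filter_forall => j; apply: cp; rewrite divr_gt0.
apply: filterS => s ps y yb.
rewrite !(horner_coef_wide _ (sp _)) -sumrB (le_lt_trans (ler_normc_sum _ _))//.
apply: (@le_lt_trans _ _ (\sum_(j < d.+1) e / K * b ^+ j)).
  apply: ler_sum => j _; rewrite -mulrBl normcM normcX.
  apply: ler_pM; rewrite ?exprn_ge0 ?normc_ge0//; first exact/ltW.
  by rewrite lerXn2r// nnegrE ?normc_ge0// ltW.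
by rewrite -mulr_sumr -mulrA gtr_pMr// mulrC ltr_pdivrMr// mul1r ltrDr.
Qed.

Lemma disk_free_connected (A : set T) : connected A ->
  (forall t y, A t -> normc y = b -> (P t).[y] != 0) ->
  forall t0 t, A t0 -> disk_free b (P t0) -> A t -> disk_free b (P t).
Proof.
move=> cA circ; apply: connected_clopen_ind => // t At pt.
  (* Openness: values that move by less than the lower bound [k] cannot reach 0. *)
  have [k k0 pk] := disk_free_lb (ltW b0) pt.
  apply: filterS (horner_near t k0) => s ps _ y yb; apply/eqP => sy0.
  by have := ps y yb; rewrite sy0 sub0r normc_opp ltNge pk.
(* Polynomials without zeros in the disk satisfy the Harnack-type bound [disk_free_ratio];
   a limit of such polynomials with a zero y0 inside would thus vanish on the circle. *)
have [y0 [y0b py0]] : exists y, normc y < b /\ (P t).[y] = 0.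
  apply: contrapT => h; apply: pt => y; rewrite le_eqVlt => /predU1P[/circ-> //|yb].
  by apply/eqP => py; apply: h; exists y.
have nb : normc b%:C = b by rewrite normc_real// ltW.
set m := normc (P t).[b%:C].
have m0 : 0 < m by rewrite normc_gt0 circ.
set K := (1 + 2 * b / (b - normc y0)) ^+ d.
have K0 : 0 <= K.
  by rewrite exprn_ge0// addr_ge0// divr_ge0 ?mulr_ge0 ?subr_ge0 ?ltW.
(* With this tolerance, a nearby zero-free [P s] would give
   [m < m / (1 + K) + K * (m / (1 + K)) = m]: the first term bounds the change at [b], the second
   the value of [P s] at [b], deduced from its value at [y0]. *)
have e0 : 0 < m / (1 + K) by rewrite divr_gt0// ltr_wpDr.
apply: filterS (horner_near t e0) => s ps _ dfs.
have h1 := ps _ (ltW y0b); rewrite py0 subr0 in h1.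
have h2 : normc ((P s).[b%:C] - (P t).[b%:C]) < m / (1 + K) by apply: ps; rewrite [normc _]nb.
have /(_ b%:C) := disk_free_ratio (ltW b0) dfs (sp s) y0b; rewrite nb => /(_ (lexx b)) h3.
have h4 := ler_normcB (P t).[b%:C] (P s).[b%:C].
rewrite normcB -/m in h4.
have h5 : K * normc (P s).[y0] <= K * (m / (1 + K)) by rewrite ler_wpM2l// ltW.
have h6 : m / (1 + K) + K * (m / (1 + K)) = m.
  by rewrite -{1}[m / _]mul1r -mulrDl mulrC divfK// gt_eqF// ltr_wpDr.
rewrite -/K in h3; lra.
Qed.

End Family.

(** Reversal at a fixed [d], not at the degree of [p]: the coefficients depend continuously on those
    of [p], and a drop of degree appears as a zero at 0. *)
Definition rev_poly (d : nat) (p : {poly R[i]}) : {poly R[i]} :=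
  \poly_(j < d.+1) p`_(d - j).

Lemma size_rev_poly d p : (size (rev_poly d p) <= d.+1)%N.
Proof. exact: size_poly. Qed.

Lemma rev_poly0 d p : (rev_poly d p).[0] = p`_d.
Proof. by rewrite horner_coef0 coef_poly subn0. Qed.

Lemma horner_rev_poly d p y : (size p <= d.+1)%N -> y != 0 ->
  p.[y] = y ^+ d * (rev_poly d p).[y^-1].
Proof.
move=> sp y0; rewrite (horner_coef_wide _ sp) (horner_coef_wide _ (size_rev_poly d p)).
rewrite (reindex_inj rev_ord_inj) mulr_sumr /=; apply: eq_bigr => j _.
rewrite coef_poly ltn_ord subSS mulrCA; congr (_ * _).
have jd : (j <= d)%N by rewrite -ltnS.
by rewrite exprVn; apply: (mulIf (expf_neq0 j y0)); rewrite divfK ?expf_neq0// -exprD subnK.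
Qed.

(** Inversion exchanges the nonzero points of the closed disk of radius [b^-1] with the points of
    modulus at least [b]. At the remaining point 0 the reversed polynomial takes the coefficient of
    degree [d] as its value, and its nonvanishing says that [p] has exactly [d] roots. *)
Lemma roots_inside_disk_free d p b : 0 < b -> p != 0 -> (size p <= d.+1)%N ->
  roots_inside d p b <-> disk_free b^-1 (rev_poly d p).
Proof.
move=> b0 p0 sp.
have vb0 : 0 <= b^-1 by rewrite invr_ge0 ltW.
split=> [[sd rb] y yb|df].
  have [->|y0] := eqVneq y 0.
    by rewrite rev_poly0 -sd -[size _]/(_.+1.-1) -size_proots// -lead_coefE lead_coef_eq0.
  have : p.[y^-1] != 0.
    rewrite -mem_proots//; apply/negP => /rb; rewrite normcV.
    by rewrite ltNge -[b]invrK lef_pV2 ?posrE ?invr_gt0 ?normc_gt0// yb.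
  by rewrite (horner_rev_poly sp) ?invr_eq0// invrK mulf_eq0 negb_or => /andP[].
have pd : p`_d != 0.
  by rewrite -rev_poly0; apply: df; rewrite normc0.
have sd : size p = d.+1.
  apply/eqP; rewrite eqn_leq sp ltnNge; apply: contra pd => ?.
  by rewrite nth_default.
split=> [|z zp]; first by move: sd; rewrite size_proots// => -[].
rewrite ltNge; apply/negP => bz.
have z0 : z != 0 by rewrite -normc_gt0 (lt_le_trans b0).
move: zp; rewrite mem_proots// (horner_rev_poly sp)// mulf_eq0 expf_eq0 (negbTE z0) andbF/=.
by apply/negP/df; rewrite normcV lef_pV2 ?posrE// normc_gt0.
Qed.

Lemma rev_disk_free_connected (T : topologicalType) (P : T -> {poly R[i]})
    (d : nat) b (A : set T) : 0 < b -> (forall t, (size (P t) <= d.+1)%N) ->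
  (forall t j (e : R), 0 < e -> \forall s \near t, normc ((P s)`_j - (P t)`_j) < e) ->
  connected A -> (forall t y, A t -> normc y = b -> (P t).[y] != 0) ->
  forall t0 t, A t0 -> disk_free b^-1 (rev_poly d (P t0)) -> A t ->
    disk_free b^-1 (rev_poly d (P t)).
Proof.
move=> b0 sP cP cA circ; apply: (@disk_free_connected T _ d) => //.
- by rewrite invr_gt0.
- by move=> t; exact: size_rev_poly.
- move=> t j e e0; have := cP t (d - j)%N e e0; apply: filterS => s.
  by rewrite !coef_poly; case: ifP => // _ _; rewrite subrr normc0.
move=> t y At yb.
have y0 : y != 0 by rewrite -normc_gt0 yb invr_gt0.
have : (P t).[y^-1] != 0 by apply: circ => //; rewrite normcV yb invrK.
by rewrite (horner_rev_poly (sP t)) ?invr_eq0// invrK mulf_eq0 negb_or => /andP[].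
Qed.

End DiskFree.

(** * Complex functions with real and imaginary parts in a ring of real functions *)

Section RingClosed.
Variables (R : realType) (T : Type) (S : (T -> R) -> Prop).

(** Continuity and measurability both have these closure properties, so polynomial expressions are
    handled once for the two. *)
Definition fun_ring_closed := [/\ forall c : R, S (fun=> c),
  forall f g, S f -> S g -> S (fun t => f t + g t) &
  forall f g, S f -> S g -> S (fun t => f t * g t)].

Definition cpx (f : T -> R[i]) :=
  S (fun t => complex.Re (f t)) /\ S (fun t => complex.Im (f t)).

Hypothesis cS : fun_ring_closed.

Lemma cpx_cst c : cpx (fun=> c).
Proof. by case: cS => Sc _ _; split. Qed.

Lemma eq_cpx f g : f =1 g -> cpx f -> cpx g.
Proof. by move=> /funext->. Qed.

Lemma cpxD f g : cpx f -> cpx g -> cpx (fun t => f t + g t).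
Proof.
case: cS => _ SD _ [f1 f2] [g1 g2]; split.
- by rewrite (_ : (fun _ => _) = (fun t => complex.Re (f t) + complex.Re (g t)));
    [exact: SD|apply/funext => t; case: (f t) (g t) => ? ? []].
- by rewrite (_ : (fun _ => _) = (fun t => complex.Im (f t) + complex.Im (g t)));
    [exact: SD|apply/funext => t; case: (f t) (g t) => ? ? []].
Qed.

Lemma cpxM f g : cpx f -> cpx g -> cpx (fun t => f t * g t).
Proof.
case: cS => Sc SD SM [f1 f2] [g1 g2]; split.
- rewrite (_ : (fun _ => _) = (fun t => complex.Re (f t) * complex.Re (g t) +
      (-1) * (complex.Im (f t) * complex.Im (g t)))).
    by apply/SD/SM/SM; first exact: SM.
  by apply/funext => t; case: (f t) (g t) => ? ? [? ?] /=; rewrite mulN1r.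
- rewrite (_ : (fun _ => _) = (fun t => complex.Re (f t) * complex.Im (g t) +
      complex.Im (f t) * complex.Re (g t))).
    by apply: SD; apply: SM.
  by apply/funext => t; case: (f t) (g t) => ? ? [? ?].
Qed.

Lemma cpxX f n : cpx f -> cpx (fun t => f t ^+ n).
Proof.
move=> Sf; elim: n => [|n IH]; first exact: cpx_cst.
by apply: eq_cpx (cpxM Sf IH) => t; rewrite exprS.
Qed.

Lemma cpxB f g : cpx f -> cpx g -> cpx (fun t => f t - g t).
Proof.
move=> Sf Sg; apply: eq_cpx (cpxD Sf (cpxM (cpx_cst (-1)) Sg)) => t.
by rewrite mulN1r.
Qed.

Lemma cpx_sum (I : Type) (s : seq I) (F : I -> T -> R[i]) :
  (forall i, cpx (F i)) -> cpx (fun t => \sum_(i <- s) F i t).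
Proof.
move=> SF; elim: s => [|i s IH].
  by apply: eq_cpx (cpx_cst 0) => t; rewrite big_nil.
by apply: eq_cpx (cpxD (SF i) IH) => t; rewrite big_cons.
Qed.

Lemma cpx_prod (I : Type) (s : seq I) (F : I -> T -> R[i]) :
  (forall i, cpx (F i)) -> cpx (fun t => \prod_(i <- s) F i t).
Proof.
move=> SF; elim: s => [|i s IH].
  by apply: eq_cpx (cpx_cst 1) => t; rewrite big_nil.
by apply: eq_cpx (cpxM (SF i) IH) => t; rewrite big_cons.
Qed.

Lemma cpx_horner (p : {poly R[i]}) f : cpx f -> cpx (fun t => p.[f t]).
Proof.
move=> Sf; apply: (@eq_cpx (fun t => \sum_(j < size p) p`_j * f t ^+ j)).
  by move=> t; rewrite horner_coef.
by apply: cpx_sum => j; apply: cpxM; [exact: cpx_cst|exact: cpxX].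
Qed.

End RingClosed.

(** * Circle parametrization, with continuity and measurability of log-moduli *)

Section Circle.
Variable R : realType.
Implicit Types a t : R.

Lemma normc_circle a t : 0 <= a -> normc (circle_pt a t) = a.
Proof.
move=> a0; rewrite /circle_pt normcM normc_real// /normc.
by rewrite cos2Dsin2 sqrtr1 mulr1.
Qed.

Lemma circle_neq0 a t : 0 < a -> circle_pt a t != 0.
Proof. by move=> a0; rewrite -normc_gt0 normc_circle// ltW. Qed.

Lemma circleV a t : (circle_pt a t)^-1 = circle_pt a^-1 (- t).
Proof.
(* For [a = 0] both sides are 0, by the convention that the inverse of 0 is 0. *)
have [->|a0] := eqVneq a 0; first by rewrite /circle_pt invr0 !mul0r invr0.
have cc : (cos t +i* sin t) * (cos (- t) +i* sin (- t)) = 1 :> R[i].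
  rewrite cosN sinN; apply/eqP; rewrite eq_complex /= mulrN opprK -!expr2.
  by rewrite cos2Dsin2 eqxx/= mulrN mulrC addNr.
have c1 : circle_pt a t * circle_pt a^-1 (- t) = 1.
  by rewrite /circle_pt mulrACA cc mulr1 -rmorphM/= mulfV.
have c0 : circle_pt a t != 0.
  by apply: contra_eq_neq c1 => ->; rewrite mul0r eq_sym oner_neq0.
by apply: (mulfI c0); rewrite c1 mulfV.
Qed.

Lemma circle1E a t : circle_pt a t = a%:C * circle_pt 1 t.
Proof. by rewrite /circle_pt mul1r. Qed.

Lemma circle_sqr t : circle_pt 1 t ^+ 2 = circle_pt 1 (2 * t) :> R[i].
Proof.
rewrite /circle_pt !mul1r mulr_natl cos_mulr2n sin_mulr2n -(cos2Dsin2 t).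
move: (cos t) (sin t) => c s; apply/eqP; rewrite expr2 eq_complex /=.
by apply/andP; split; apply/eqP; ring.
Qed.

Lemma circleDpi t : circle_pt 1 (t + pi) = - circle_pt 1 t :> R[i].
Proof.
rewrite /circle_pt !mul1r cosD sinD cospi sinpi !mulr0 !mulrN1 subr0 addr0.
by [].
Qed.

Lemma circle_conj a t : (circle_pt a t)^*%C = circle_pt a (- t).
Proof.
rewrite /circle_pt cosN sinN rmorphM /=; congr (_ * _).
by rewrite oppr0.
Qed.

Section Closed.
Variables (T : Type) (S : (T -> R) -> Prop) (th : T -> R).
Hypotheses (cS : fun_ring_closed S).
Hypotheses (Sc : S (fun u => cos (th u))) (Ss : S (fun u => sin (th u))).

Lemma cpx_circle a : cpx S (fun u => circle_pt a (th u)).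
Proof. by apply: cpxM; [|exact: cpx_cst|split]. Qed.

(** By [circleV] the inverse is a circle point of opposite angle, so it is again built from a cosine
    and a sine by ring operations. *)
Lemma cpx_circleV a : cpx S (fun u => (circle_pt a (th u))^-1).
Proof.
under eq_fun do rewrite circleV /circle_pt cosN sinN.
apply: cpxM => //; first exact: cpx_cst.
split=> //=; case: cS => Sk _ SM.
under eq_fun do rewrite -mulN1r; exact: SM.
Qed.

Lemma cpx_circleX a (k : int) : cpx S (fun u => circle_pt a (th u) ^ k).
Proof.
case: k => n; first by apply: (cpxX cS n); exact: cpx_circle.
by under eq_fun do rewrite NegzE -exprnN -exprVn; apply: (cpxX cS _); exact: cpx_circleV.
Qed.

End Closed.

Lemma continuous_ring_closed (T : topologicalType) :
  fun_ring_closed (fun f : T -> R => continuous f).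
Proof.
split=> [c|f g cf cg|f g cf cg] t; first exact: cvg_cst.
- by apply: cvgD; [exact: cf|exact: cg].
- by apply: cvgM; [exact: cf|exact: cg].
Qed.

Lemma measurable_ring_closed d (T : measurableType d) :
  fun_ring_closed (fun f : T -> R => measurable_fun setT f).
Proof.
split=> [c|f g cf cg|f g cf cg]; first exact: measurable_cst.
- exact: measurable_funD.
- exact: measurable_funM.
Qed.

Notation ccont := (@cpx R _ (fun f => continuous f)).

Lemma normcE (z : R[i]) : normc z = Num.sqrt (complex.Re z ^+ 2 + complex.Im z ^+ 2).
Proof. by case: z. Qed.

Lemma continuous_normc (T : topologicalType) (f : T -> R[i]) :
  ccont f -> continuous (fun u => normc (f u)).
Proof.
move=> [fr fi] u; under eq_fun do rewrite normcE.
apply: (@continuous_comp _ _ _ (fun u => complex.Re (f u) ^+ 2 + complex.Im (f u) ^+ 2) Num.sqrt).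
  by apply: cvgD; under eq_fun do rewrite expr2; apply: cvgM; [exact: fr|exact: fr|exact: fi|exact: fi].
exact: sqrt_continuous.
Qed.

Lemma continuous_ln_normc (T : topologicalType) (f : T -> R[i]) :
  ccont f -> (forall u, f u != 0) -> continuous (fun u => ln (normc (f u))).
Proof.
move=> cf f0 u; apply: (@continuous_comp _ _ _ (fun u => normc (f u)) (@ln R)).
  exact: continuous_normc.
by apply: continuous_ln; rewrite normc_gt0.
Qed.

Lemma measurable_ln_normc d (T : measurableType d) (f : T -> R[i]) :
  cpx (fun f => measurable_fun setT f) f ->
  measurable_fun setT (fun u => ln (normc (f u))).
Proof.
move=> [fr fi]; apply: measurableT_comp; first exact: measurable_ln.
under eq_fun do rewrite normcE.
apply: measurableT_comp; last first.
  by apply: measurable_funD; under eq_fun do rewrite expr2; exact: measurable_funM.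
by apply: continuous_measurable_fun; exact: sqrt_continuous.
Qed.

Lemma ccont_near (T : topologicalType) (f : T -> R[i]) (v : T) (e : R) :
  ccont f -> 0 < e -> \forall u \near v, normc (f u - f v) < e.
Proof.
move=> cf e0; have C := continuous_ring_closed T.
have /(_ v)/cvgrPdist_lt/(_ _ e0) := continuous_normc (cpxB C cf (cpx_cst C (f v))).
apply: filterS => u; rewrite subrr normc0 sub0r normrN ger0_norm//.
exact: normc_ge0.
Qed.

Lemma ccont_circle a : ccont (circle_pt a).
Proof.
apply: (@cpx_circle _ _ id (continuous_ring_closed R)).
- exact: continuous_cos.
- exact: continuous_sin.
Qed.

End Circle.

(** * Integrals of continuous functions over segments *)

Section Integral.
Variable R : realType.
Notation mu := (@lebesgue_measure R).
Implicit Types (f g : R -> R) (a b c d : R).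

Lemma continuous_integrable a b f : continuous f ->
  mu.-integrable `[a, b] (EFin \o f).
Proof.
move=> cf; apply: continuous_compact_integrable; first exact: segment_compact.
exact: continuous_subspaceT.
Qed.

Lemma Rintegral_split a c b f : continuous f -> a <= c -> c <= b ->
  \int[mu]_(t in `[a, b]) f t =
  \int[mu]_(t in `[a, c]) f t + \int[mu]_(t in `[c, b]) f t.
Proof.
(* Removing the endpoint [c] from the second segment leaves its integral unchanged and makes the two
   pieces disjoint. *)
move=> cf ac cb; rewrite -(@Rintegral_itv_obnd_cbnd _ c); last first.
  apply: integrableS (continuous_integrable c b cf) => //.
  exact: subset_itv_oc_cc.
rewrite -(@Rintegral_itvB _ f (BLeft a)) ?bnd_simp//; last exact: continuous_integrable.
by rewrite addrC subrK.
Qed.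

Lemma Rintegral_affine c d a b g : 0 < c -> a <= b -> continuous g ->
  \int[mu]_(t in `[c * a + d, c * b + d]) g t =
  c * \int[mu]_(t in `[a, b]) g (c * t + d).
Proof.
move=> c0 ab cg; pose F t := c * t + d.
have cF : continuous F.
  by move=> t; apply: cvgD; [apply: cvgMr; exact: cvg_id|exact: cvg_cst].
have dF (t : R) : is_derive t (1 : R) F c.
  rewrite (_ : F = c *: (@id R) + cst d)//; apply: is_derive_eq.
  by rewrite addr0 /GRing.scale /= mulr1.
have F' : derive1 F = cst c by apply/funext => t; rewrite derive1E derive_val.
rewrite /Rintegral -[c * a + d]/(F a) -[c * b + d]/(F b).
rewrite (@integration_by_substitution_increasing R F g a b) //; last 6 first.
- by move=> x y _ _ xy; rewrite ltrD2r ltr_pM2l.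
- by rewrite F' => x _; exact: cvg_cst.
- by rewrite F'; exact: is_cvg_cst.
- by rewrite F'; exact: is_cvg_cst.
- split; [by move=> x _; exact: ex_derive| |].
    exact/cvg_at_right_filter/cF.
  exact/cvg_at_left_filter/cF.
- exact: continuous_subspaceT.
have cgF : continuous (g \o F).
  by move=> t; apply: continuous_comp; [exact: cF|exact: cg].
rewrite -[fine _]/(Rintegral mu `[a, b] ((g \o F) * derive1 F)) F'.
rewrite -RintegralZl//; last exact: continuous_integrable.
by apply: eq_Rintegral => t _; rewrite /= mulrC.
Qed.

Lemma Rintegral_bound a b f M : a <= b -> continuous f ->
  (forall t, `|f t| <= M) -> `|\int[mu]_(t in `[a, b]) f t| <= (b - a) * M.
Proof.
move=> ab cf fM.
have cn : continuous (fun t => `|f t|).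
  by move=> t; apply: cvg_norm; exact: cf.
have cc : continuous (fun _ : R => M) by move=> t; exact: cvg_cst.
apply: (le_trans (le_normr_Rintegral _ _)) => //; first exact: continuous_integrable.
apply: (@le_trans _ _ (\int[mu]_(t in `[a, b]) M)).
  by apply: le_Rintegral => //; exact: continuous_integrable.
rewrite Rintegral_cst//= lebesgue_measure_itv/= mulrC.
rewrite lte_fin; move: ab; rewrite le_eqVlt => /predU1P[->|ab]; last by rewrite ab.
by rewrite ltxx subrr.
Qed.

End Integral.

(** * Jensen's formula for a polynomial without zeros in a closed disk *)

Section Jensen.
Variable R : realType.
Notation mu := (@lebesgue_measure R).
Implicit Types (s : seq R[i]) (w z : R[i]) (b : R) (p : {poly R[i]}).

(** Normalized to the value 1 at [w = 0]; the zeros are the inverses of the nonzero members of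
    [s]. *)
Let F s w : R[i] := \prod_(z <- s) (1 - z * w).

Let F_sqr s w : F [seq z ^+ 2 | z <- s] (w ^+ 2) = F s w * F s (- w).
Proof.
rewrite /F big_map -big_split /=; apply: eq_bigr => z _.
by ring.
Qed.

Let g s (t : R) := ln (normc (F s (circle_pt 1 t))).
Let J s := \int[mu]_(t in `[0, 2 * pi]) g s t.

(** A common bound [q < 1] passes to the squares and keeps the estimates on [g] uniform along the
    iteration. *)
Let small (q : R) s := forall z, z \in s -> normc z <= q.

Let small_bound q s w : 0 <= q -> q < 1 -> small q s -> normc w = 1 ->
  (1 - q) ^+ size s <= normc (F s w) <= (1 + q) ^+ size s.
Proof.
move=> q0 q1 sq w1; rewrite /F normc_prod.
have E (x : R) : x ^+ size s = \prod_(z <- s) x.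
  by rewrite big_const_seq count_predT iter_mulr_1.
have nzw z : normc (z * w) = normc z by rewrite normcM w1 mulr1.
rewrite !E; apply/andP; split; rewrite big_seq [leRHS]big_seq ler_prod// => z zs.
  rewrite subr_ge0 (ltW q1)/= (le_trans _ (ler_normcB _ _))// normc1 nzw.
  by rewrite lerD2l lerN2 sq.
by rewrite normc_ge0/= (le_trans (ler_normcD _ _))// normc1 lerD2l normc_opp nzw sq.
Qed.

(** The logarithms of [1 - q] and [1 + q] have opposite signs, so their difference dominates both.
    Only [q] and the size of [s] enter, and squaring preserves them. *)
Let g_bound q s t : 0 <= q -> q < 1 -> small q s ->
  `|g s t| <= (size s)%:R * (ln (1 + q) - ln (1 - q)).
Proof.
move=> q0 q1 sq.
have /andP[h1 h2] := small_bound q0 q1 sq (normc_circle t (@ler01 R)).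
have q1' : 0 < 1 - q by rewrite subr_gt0.
have q1'' : 0 < 1 + q by rewrite ltr_wpDr.
have F0 : 0 < normc (F s (circle_pt 1 t)).
  by apply: lt_le_trans h1; rewrite exprn_gt0.
have l1 : ln ((1 - q) ^+ size s) <= g s t by rewrite ler_ln ?posrE ?exprn_gt0.
have l2 : g s t <= ln ((1 + q) ^+ size s) by rewrite ler_ln ?posrE ?exprn_gt0.
have l3 : ln (1 - q) <= 0 by rewrite ln_le0// gerBl.
have l4 : 0 <= ln (1 + q) by rewrite ln_ge0// lerDl.
rewrite lnXn// -mulr_natl in l1; rewrite lnXn// -mulr_natl in l2.
have n0 : 0 <= (size s)%:R :> R by [].
have := mulr_ge0 n0 l4; have : (size s)%:R * ln (1 - q) <= 0 by rewrite mulr_ge0_le0.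
by rewrite mulrBr ler_norml => *; apply/andP; split; lra.
Qed.

Let F_neq0 q s t : 0 <= q -> q < 1 -> small q s -> F s (circle_pt 1 t) != 0.
Proof.
move=> q0 q1 sq; rewrite -normc_gt0.
have /andP[h1 _] := small_bound q0 q1 sq (normc_circle t (@ler01 R)).
by apply: lt_le_trans h1; rewrite exprn_gt0// subr_gt0.
Qed.

Let g_cont q s : 0 <= q -> q < 1 -> small q s -> continuous (g s).
Proof.
move=> q0 q1 sq; apply: continuous_ln_normc; last by move=> t; exact: F_neq0 sq.
have C := continuous_ring_closed R R; rewrite /F.
apply: (cpx_prod C) => z; apply: (cpxB C); first exact: (cpx_cst C).
by apply: (cpxM C); [exact: (cpx_cst C)|exact: ccont_circle].
Qed.

Let small_sqr q s : 0 <= q -> q < 1 -> small q s -> small q [seq z ^+ 2 | z <- s].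
Proof.
move=> q0 q1 sq _ /mapP[z zs ->]; rewrite normcX (le_trans _ (sq z zs))//.
by rewrite expr2 ler_piMl ?normc_ge0// (le_trans (sq z zs))// ltW.
Qed.

(** Doubling the angle maps half a period onto the full circle, and [t + pi] gives the antipodal
    point; folding [J s] onto the segment from 0 to [pi] therefore produces the product
    [F s w * F s (- w)] of [F_sqr]. *)
Let J_sqr q s : 0 <= q -> q < 1 -> small q s ->
  J [seq z ^+ 2 | z <- s] = 2 * J s.
Proof.
move=> q0 q1 sq; have cg := g_cont q0 q1 sq.
have cg2 := g_cont q0 q1 (small_sqr q0 q1 sq).
have pi0 : 0 <= pi :> R := pi_ge0 R.
have pi2 : pi <= 2 * pi :> R by lra.
have -> : J [seq z ^+ 2 | z <- s] =
    2 * \int[mu]_(t in `[0, pi]) g [seq z ^+ 2 | z <- s] (2 * t).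
  have := Rintegral_affine 0 (ltr0n R 2) pi0 cg2; rewrite mulr0 !addr0 [J _]/J => ->.
  by under eq_Rintegral do rewrite addr0.
congr (2 * _).
have cgpi : continuous (fun t => g s (t + pi)).
  move=> t; apply: continuous_comp; last exact: cg.
  by apply: cvgD; [exact: cvg_id|exact: cvg_cst].
have -> : J s = \int[mu]_(t in `[0, pi]) (g s t + g s (t + pi)).
  rewrite /J (Rintegral_split cg pi0 pi2).
  rewrite RintegralD; [|exact: measurable_itv|exact: continuous_integrable..].
  congr (Rintegral _ _ _ + _).
  have := Rintegral_affine pi (@ltr01 R) pi0 cg.
  rewrite mulr0 add0r !mul1r -mulr2n -(mulr_natl pi) => ->.
  by under eq_Rintegral do rewrite mul1r.
apply: eq_Rintegral => t _; rewrite /g -lnM ?posrE ?normc_gt0 ?(F_neq0 _ q0 q1 sq)//.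
by rewrite -normcM circleDpi -F_sqr circle_sqr.
Qed.

Let J0 q s : 0 <= q -> q < 1 -> small q s -> J s = 0.
Proof.
move=> q0 q1 sq; pose sn n := iter n (map (fun z => z ^+ 2)) s.
have ssn n : small q (sn n) /\ size (sn n) = size s.
  elim: n => // n [IH1 IH2] /=; split; first exact: small_sqr.
  by rewrite size_map.
have Jn n : J (sn n) = 2 ^+ n * J s.
  elim: n => [|n IH]; first by rewrite expr0 mul1r.
  by rewrite /= (J_sqr q0 q1 (ssn n).1) IH exprS mulrA.
(* [M] serves every iterate, since [sn n] has the size of [s] and satisfies the same bound [q]. *)
set M := 2 * pi * ((size s)%:R * (ln (1 + q) - ln (1 - q))).
have JM n : 2 ^+ n * `|J s| <= M.
  have -> : 2 ^+ n * `|J s| = `|J (sn n)|.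
    by rewrite Jn normrM normrX normr_nat.
  rewrite (le_trans (@Rintegral_bound _ _ _ _ ((size s)%:R * (ln (1 + q) - ln (1 - q))) _ _ _))//.
  - by rewrite mulr_ge0// pi_ge0.
  - exact: g_cont (ssn n).1.
  - by move=> t; rewrite -(ssn n).2; apply: g_bound (ssn n).1.
  - by rewrite subr0.
apply/eqP; rewrite -normr_le0 leNgt; apply/negP => Js0.
have M0 : 0 <= M by apply: le_trans (JM 0%N); rewrite mulr_ge0.
(* By the Archimedean property and [n < 2 ^ n], some power of 2 breaks the bound [JM] when [J s] is
   nonzero. *)
have [n nM] : exists n : nat, M / `|J s| < n%:R.
  exists (Num.bound (M / `|J s|)).
  by apply: archi_boundP; rewrite divr_ge0.
have := JM n; rewrite leNgt => /negP; apply.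
rewrite -ltr_pdivrMr// (lt_trans nM)// -natrX ltr_nat.
exact: ltn_expl.
Qed.

(** Factoring out [p.[0]] leaves the product [F] over the quotients [b / z] by the roots, all of
    modulus below 1, and the logarithm of its modulus integrates to 0. *)
Lemma jensen_disk_free p b : 0 <= b -> disk_free b p ->
  \int[mu]_(t in `[0, 2 * pi]) ln (normc p.[circle_pt b t]) =
  2 * pi * ln (normc p.[0]).
Proof.
move=> b0 pb; have p0 := disk_free_neq0 b0 pb.
have rb := disk_free_roots b0 pb.
have z0 z : z \in proots p -> z != 0.
  by move=> /rb bz; rewrite -normc_gt0 (le_lt_trans b0).
pose s := [seq b%:C / z | z <- proots p].
have pF t : p.[circle_pt b t] = p.[0] * F s (circle_pt 1 t).
  rewrite !horner_proots -mulrA /F big_map -big_split/=; congr (_ * _).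
  rewrite big_seq [RHS]big_seq; apply: eq_bigr => z /z0 zn0.
  by rewrite circle1E; field.
(* The maximum of the finitely many moduli serves as [q]; starting it at 0 covers a constant [p]. *)
have [q [q0 q1 sq]] : exists q, [/\ 0 <= q, q < 1 & small q s].
  exists (\big[Num.max/0]_(z <- s) normc z); split.
  - by apply: bigmax_ge_id.
  - rewrite big_seq; apply: bigmax_lt => //= _ /mapP[z zp ->].
    rewrite normcM normcV normc_real// ltr_pdivrMr ?mul1r ?rb//.
    by rewrite normc_gt0 z0.
  - by move=> z zs; apply: le_bigmax_seq.
have p00 : p.[0] != 0 by apply: pb; rewrite normc0.
under eq_Rintegral => t _.
  rewrite pF normcM lnM ?posrE ?normc_gt0 ?(F_neq0 _ q0 q1 sq)//; over.
have cc : continuous (fun _ : R => ln (normc p.[0])) by move=> t; exact: cvg_cst.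
rewrite RintegralD//; try apply: continuous_integrable => //; last exact: g_cont sq.
rewrite -/(J s) (J0 q0 q1 sq) addr0 Rintegral_cst//= lebesgue_measure_itv/= lte_fin.
by rewrite mulr_gt0 ?pi_gt0//= subr0 mulrC.
Qed.

End Jensen.

(** * Jensen's formula with all zeros inside the circle, and the exponents nu *)

Section Roots.
Variable R : realType.
Notation mu := (@lebesgue_measure R).
Implicit Types (p : {poly R[i]}) (b : R) (d v : nat).

(** The inverse of [circle_pt b t] is the conjugate of [circle_pt b^-1 t]. Conjugating the
    coefficients of the reversed polynomial absorbs this conjugation without changing moduli, so the
    zero-free case applies with the same parameter [t]. *)
Lemma jensen_rev_disk_free p d b : 0 < b -> (size p <= d.+1)%N ->
  disk_free b^-1 (rev_poly d p) ->
  \int[mu]_(t in `[0, 2 * pi]) ln (normc p.[circle_pt b t]) =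
  2 * pi * (ln (normc p`_d) + d%:R * ln b).
Proof.
move=> b0 sp pb; have b0' : 0 <= b^-1 by rewrite invr_ge0 ltW.
set q := map_poly (@conjc R) (rev_poly d p).
have qE (y : R[i]) : q.[y^*%C] = ((rev_poly d p).[y])^*%C by rewrite horner_map.
have qb : disk_free b^-1 q.
  move=> y yb; rewrite -[y]conjcK qE fmorph_eq0; apply: pb.
  by rewrite normc_conj.
have q0 : q.[0] != 0 by apply: qb; rewrite normc0.
have nq0 : normc q.[0] = normc p`_d.
  by have := qE 0; rewrite conjc0 => ->; rewrite normc_conj rev_poly0.
have pE t : ln (normc p.[circle_pt b t]) =
    ln (normc q.[circle_pt b^-1 t]) + d%:R * ln b.
  have c0 := circle_neq0 t b0.
  rewrite (horner_rev_poly sp c0) normcM normcX normc_circle ?(ltW b0)//.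
  rewrite circleV -circle_conj -[(rev_poly d p).[_]]conjcK -qE normc_conj conjcK.
  rewrite lnM ?posrE ?exprn_gt0 ?normc_gt0//.
    by rewrite lnXn// mulr_natl addrC.
  by apply: qb; rewrite normc_circle.
under eq_Rintegral do rewrite pE.
have cc : continuous (fun _ : R => d%:R * ln b) by move=> t; exact: cvg_cst.
have cl : continuous (fun t => ln (normc q.[circle_pt b^-1 t])).
  apply: continuous_ln_normc; first exact: (cpx_horner (continuous_ring_closed R R) _ (ccont_circle _)).
  by move=> t; apply: qb; rewrite normc_circle.
rewrite RintegralD; [|exact: measurable_itv|exact: continuous_integrable..].
rewrite (jensen_disk_free b0' qb) nq0 [RHS]mulrDr; congr (_ + _).
rewrite Rintegral_cst//= lebesgue_measure_itv/= lte_fin.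
by rewrite mulr_gt0 ?pi_gt0//= subr0 mulrC.
Qed.

(** [nzeros] omits the root 0 and [pole_order] restores its multiplicity; together they count all
    [d] roots. *)
Lemma nu_inside p d v b : p != 0 -> roots_inside d p b ->
  (nzeros p b)%:Z - pole_order v p = d%:Z - v%:Z.
Proof.
move=> p0 [sd rb]; rewrite /pole_order mup_proots// opprB addrA -PoszD; congr (Posz _ - _).
rewrite -sd -(count_predT (proots p)) -[RHS](count_predC (pred1 (0 : R[i]))).
rewrite addnC; congr (_ + _)%N; apply: eq_in_count => z zp /=.
by rewrite normc_gt0 rb// andbT.
Qed.

(** The root 0 is excluded too, since it would lie inside the circle; only the exponent [v]
    remains. *)
Lemma nu_outside p v b : 0 <= b -> p != 0 -> roots_outside p b ->
  (nzeros p b)%:Z - pole_order v p = - v%:Z.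
Proof.
move=> b0 p0 rb; rewrite /pole_order mup_proots//.
have -> : count_mem 0 (proots p) = 0%N.
  apply/eqP; rewrite -leqn0 leqNgt -has_count; apply/hasP => -[z /rb + /eqP z0].
  by rewrite z0 normc0 ltNge b0.
have -> : nzeros p b = 0%N.
  apply/eqP; rewrite -leqn0 leqNgt -has_count; apply/hasP => -[z /rb bz /andP[_ zb]].
  by move: bz; rewrite ltNge ltW.
by rewrite subr0 sub0r.
Qed.

End Roots.

(** * Fubini's theorem for bounded functions on rectangles *)

Section Fubini.
Variable R : realType.

Lemma Rintegral_setX d1 d2 (T1 : measurableType d1) (T2 : measurableType d2)
    (m1 : {sigma_finite_measure set T1 -> \bar R})
    (m2 : {sigma_finite_measure set T2 -> \bar R})
    (A : set T1) (B : set T2) (f : T1 * T2 -> R) (M : R) :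
  measurable A -> measurable B -> (m1 A < +oo)%E -> (m2 B < +oo)%E ->
  measurable_fun setT f -> (forall x y, A x -> B y -> `|f (x, y)| <= M) ->
  \int[(m1 \x m2)%E]_(z in A `*` B) f z =
    \int[m1]_(x in A) \int[m2]_(y in B) f (x, y) /\
  \int[(m1 \x m2)%E]_(z in A `*` B) f z =
    \int[m2]_(y in B) \int[m1]_(x in A) f (x, y).
Proof.
move=> mA mB iA iB mf fM.
have mAB : measurable (A `*` B) by exact: measurableX.
have iAB : ((m1 \x m2)%E (A `*` B) < +oo)%E.
  by rewrite product_measure1E//; apply: lte_mul_pinfty => //; rewrite ge0_fin_numE.
have bnd (T : Type) (C : set T) (g : T -> R) :
    (forall x, C x -> `|g x| <= M) -> [bounded g x | x in C].
  move=> gM; exists M; split; rewrite ?num_real// => N MN x Cx.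
  exact: le_trans (gM x Cx) (ltW MN).
have fi : (m1 \x m2)%E.-integrable (A `*` B) (EFin \o f).
  apply: measurable_bounded_integrable => //; first exact: measurable_funTS.
  by apply: bnd => -[x y] [/= Ax By]; exact: fM.
(* Integrability of the slices makes the inner integrals finite, so that [fine] may be removed from
   them. *)
have fi1 x : A x -> m2.-integrable B (fun y => (f (x, y))%:E).
  move=> Ax; apply: (@measurable_bounded_integrable _ _ _ m2 (fun y => f (x, y))) => //.
    by apply: measurable_funTS; apply: measurableT_comp => //; exact: pair1_measurable.
  by apply: bnd => y By; exact: fM.
have fi2 y : B y -> m1.-integrable A (fun x => (f (x, y))%:E).
  move=> By; apply: (@measurable_bounded_integrable _ _ _ m1 (fun x => f (x, y))) => //.
    by apply: measurable_funTS; apply: measurableT_comp => //; exact: pair2_measurable.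
  by apply: bnd => x Ax; exact: fM.
(* Fubini's theorem is applied on the full product space, to the extension of [f] by 0. *)
have fi' : (m1 \x m2)%E.-integrable setT ((EFin \o f) \_ (A `*` B)).
  have [h _] := @integrable_mkcond _ _ _ (m1 \x m2)%E _ (EFin \o f) mAB; exact: h.
split; rewrite /Rintegral integral_mkcond.
- rewrite -integral12_prod_meas1//; congr fine.
  rewrite [RHS]integral_mkcond; apply: eq_integral => x _.
  rewrite /fubini_F [RHS]/patch; case: ifPn => xA.
    rewrite fineK; last by apply: integrable_fin_num => //; exact/fi1/set_mem.
    rewrite [RHS]integral_mkcond; apply: eq_integral => y _.
    by rewrite /patch in_setX xA.
  by rewrite integral0_eq// => y _; rewrite /patch in_setX (negbTE xA).
- rewrite -integral21_prod_meas1//; congr fine.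
  rewrite [RHS]integral_mkcond; apply: eq_integral => y _.
  rewrite /fubini_G [RHS]/patch; case: ifPn => yB.
    rewrite fineK; last by apply: integrable_fin_num => //; exact/fi2/set_mem.
    rewrite [RHS]integral_mkcond; apply: eq_integral => x _.
    by rewrite /patch in_setX yB andbT.
  by rewrite integral0_eq// => x _; rewrite /patch in_setX (negbTE yB) andbF.
Qed.

Notation mu := (@lebesgue_measure R).

Lemma Rintegral_square (f : R * R -> R) (a b : R) : continuous f ->
  measurable_fun setT f ->
  \int[(mu \x mu)%E]_(z in `[a, b] `*` `[a, b]) f z =
    \int[mu]_(t in `[a, b]) \int[mu]_(s in `[a, b]) f (t, s) /\
  \int[(mu \x mu)%E]_(z in `[a, b] `*` `[a, b]) f z =
    \int[mu]_(s in `[a, b]) \int[mu]_(t in `[a, b]) f (t, s).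
Proof.
move=> cf mf.
have mD : measurable (`[a, b]%classic : set R) by exact: measurable_itv.
have iD : (mu `[a, b]%classic < +oo)%E.
  by rewrite lebesgue_measure_itv/=; case: ifP => // _; rewrite -EFinB ltry.
(* Any number above [M] bounds [f] on the compact square; [M + 1] is used below. *)
have /compact_bounded[M [_ fM]] : compact (f @` (`[a, b]%classic `*` `[a, b]%classic)).
  apply: continuous_compact; first exact: continuous_subspaceT.
  by apply: compact_setX; exact: segment_compact.
apply: (@Rintegral_setX _ _ _ _ mu mu _ _ f (M + 1)) => // x y xD yD.
by apply: (fM (M + 1)); [rewrite ltrDl|exists (x, y)].
Qed.

End Fubini.

(** * Laurent polynomials, treated uniformly in the two variables *)

Section LaurentGen.
Variable R : realType.
Implicit Types (P Q : laurent2 R) (x y r z : R[i]) (a b : R).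

Lemma QrE Q r k : Qr Q r k = (if k == (0, 0) then r else 0) - Q k.
Proof.
rewrite fsfunE; case: ifPn => //; rewrite in_fset1U negb_or => /andP[/negbTE-> kQ].
by rewrite fsfun_dflt// subrr.
Qed.

Lemma finsupp_Qr Q r k : k != (0, 0) -> (k \in finsupp (Qr Q r)) = (k \in finsupp Q).
Proof. by move=> /negbTE k0; rewrite !mem_finsupp QrE k0 sub0r oppr_eq0. Qed.

(** The supports of [Qr Q r] and [Q] can differ only at [(0, 0)], which [C] excludes. *)
Lemma bigmax_Qr Q r (C : pred (int * int)) (F : int * int -> nat) : ~~ C (0, 0) ->
  (\max_(k <- finsupp (Qr Q r) | C k) F k)%N = (\max_(k <- finsupp Q | C k) F k)%N.
Proof.
move=> C0; have nz k : C k -> k != (0, 0) by apply: contraTneq => ->.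
by apply/eqP; rewrite eqn_leq; apply/andP; split;
  apply/bigmax_leqP_seq => k kQ Ck; apply: leq_bigmax_seq => //;
  move: kQ; rewrite finsupp_Qr// nz.
Qed.

(** Whether [(0, 0)] belongs to the support depends on whether [r = 0]; summing over an enlarged
    support avoids the distinction. The module [V] covers both numbers and polynomials. *)
Lemma sum_Qr (V : lmodType R[i]) Q r (h : int * int -> V) : Q (0, 0) = 0 ->
  \sum_(k <- finsupp (Qr Q r)) Qr Q r k *: h k =
  r *: h (0, 0) - \sum_(k <- finsupp Q) Q k *: h k.
Proof.
move=> Q0; pose S := ((0, 0) |` finsupp Q)%fset.
rewrite (@big_fset_incl _ _ _ _ _ S); last 2 first.
- apply/fsubsetP => k kr; rewrite in_fset1U.
  by case: eqVneq => //= k0; rewrite -(finsupp_Qr Q r k0).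
- by move=> k _ kn; rewrite fsfun_dflt// scale0r.
rewrite [X in _ - X](@big_fset_incl _ _ _ _ _ S); last 2 first.
- exact: fsubsetU1.
- by move=> k _ kn; rewrite fsfun_dflt// scale0r.
under eq_bigr do rewrite QrE scalerBl.
rewrite sumrB; congr (_ - _).
rewrite (big_fsetD1 (0, 0)) ?in_fset1U ?eqxx//= big1_fset ?addr0// => k.
by rewrite !inE => /andP[/negbTE-> _] _; rewrite scale0r.
Qed.

(* With (u, w) = (fst, snd), gpoly is ypoly; with (u, w) = (snd, fst), it is xpoly. *)
Variables (u w : int * int -> int).
Hypotheses (u0 : u (0, 0) = 0) (w0 : w (0, 0) = 0).

Definition gpole P : nat := \max_(k <- finsupp P | w k < 0) absz (w k).
Definition gtop P : nat := \max_(k <- finsupp P | 0 < w k) absz (w k).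
Definition gpoly P x : {poly R[i]} :=
  \sum_(k <- finsupp P) (P k * x ^ u k) *: 'X^(absz (w k + (gpole P)%:Z)).
Definition gval P x y : R[i] := \sum_(k <- finsupp P) P k * x ^ u k * y ^ w k.

Section Q.
Variable Q : laurent2 R.
Hypothesis Q0 : Q (0, 0) = 0.

Let v := gpole Q.
Let d := (gtop Q + v)%N.

Let qpoly x : {poly R[i]} :=
  \sum_(k <- finsupp Q) Q k *: (x ^ u k *: 'X^(absz (w k + v%:Z))).

Lemma gpole_Qr r : gpole (Qr Q r) = v.
Proof. by apply: bigmax_Qr; rewrite w0 ltxx. Qed.

Lemma gtop_Qr r : gtop (Qr Q r) = gtop Q.
Proof. by apply: bigmax_Qr; rewrite w0 ltxx. Qed.

Lemma gval_Qr r x y : gval (Qr Q r) x y = r - gval Q x y.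
Proof.
rewrite /gval; under eq_bigr do rewrite -mulrA.
rewrite (@sum_Qr R[i]^o Q r (fun k => x ^ u k * y ^ w k))//.
rewrite u0 w0 !expr0z mulr1; congr (_ - _).
  by rewrite /GRing.scale /= mulr1.
by apply: eq_bigr => k _; rewrite -mulrA.
Qed.

(** Only the coefficient of degree [v] depends on [r], and it does so by translation, which gives
    continuity in [r]. *)
Lemma gpoly_Qr r x : gpoly (Qr Q r) x = r *: 'X^v - qpoly x.
Proof.
rewrite /gpoly gpole_Qr; under eq_bigr do rewrite -scalerA.
rewrite (@sum_Qr _ Q r (fun k => x ^ u k *: 'X^(absz (w k + v%:Z))))//.
by rewrite u0 w0 expr0z scale1r add0r.
Qed.

(** This makes [absz] the identity on the shifted exponents and bounds the degree of [gpoly] by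
    [d]. *)
Lemma gexp_bound k : k \in finsupp Q -> 0 <= w k + v%:Z /\ (absz (w k + v%:Z)%R <= d)%N.
Proof.
move=> kQ; case: (ltrgtP (w k) 0) => wk.
- have : (absz (w k) <= v)%N by rewrite /v /gpole; apply: (@leq_bigmax_seq _ _ (fun k => w k < 0) (fun k => absz (w k))).
  by rewrite /d; lia.
- have : (absz (w k) <= gtop Q)%N by rewrite /gtop; apply: (@leq_bigmax_seq _ _ (fun k => 0 < w k) (fun k => absz (w k))).
  by rewrite /d; lia.
- by rewrite wk /d; lia.
Qed.

Lemma size_gpoly r x : (size (gpoly (Qr Q r) x) <= d.+1)%N.
Proof.
rewrite gpoly_Qr (leq_trans (size_polyD _ _))// size_polyN geq_max; apply/andP; split.
  by rewrite (leq_trans (size_scale_leq _ _))// size_polyXn ltnS leq_addl.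
rewrite /qpoly big_seq; apply: (leq_trans (size_sum _ _ _)).
apply/bigmax_leqP_seq => k _ kQ.
do 2 apply: (leq_trans (size_scale_leq _ _)).
by rewrite size_polyXn ltnS; exact: (gexp_bound kQ).2.
Qed.

Lemma horner_gpoly r x y : y != 0 ->
  (gpoly (Qr Q r) x).[y] = y ^+ v * (r - gval Q x y).
Proof.
move=> y0; rewrite gpoly_Qr hornerD hornerN hornerZ hornerXn mulrBr mulrC; congr (_ - _).
rewrite /qpoly horner_sum mulr_sumr big_seq [RHS]big_seq; apply: eq_bigr => k kQ.
rewrite !hornerZ hornerXn [RHS]mulrC -!mulrA; congr (_ * (_ * _)).
rewrite -[y ^+ absz _]/(y ^ (absz (w k + v%:Z))%:Z) gez0_abs ?(gexp_bound kQ).1//.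
by rewrite expfzDr.
Qed.

Lemma coef_near_r x r j (e : R) : 0 < e ->
  \forall s \near (r : R[i]^o), normc ((gpoly (Qr Q s) x)`_j - (gpoly (Qr Q r) x)`_j) < e.
Proof.
move=> e0; apply/nbhs_ballP; exists e%:C; first by rewrite /= ltcR.
move=> s; rewrite -ball_normE /= => rs.
have {}rs : normc (r - s) < e by rewrite -ltcR -normcR.
rewrite !gpoly_Qr !coefB opprB addrA addrNK !coefZ -mulrBl normcM coefXn.
rewrite normcB; apply: le_lt_trans rs.
by case: (j == v); rewrite ?normc1 ?normc0 ?mulr1 ?mulr0// normc_ge0.
Qed.

Lemma ccont_coef a r j :
  cpx (fun f : R -> R => continuous f) (fun t => (gpoly (Qr Q r) (circle_pt a t))`_j).
Proof.
have C := continuous_ring_closed R R.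
apply: (@eq_cpx _ _ _ (fun t => (r *: 'X^v : {poly R[i]})`_j -
    \sum_(k <- finsupp Q) (Q k * ('X^(absz (w k + v%:Z)) : {poly R[i]})`_j) * circle_pt a t ^ u k)).
  move=> t; rewrite gpoly_Qr coefB; congr (_ - _).
  rewrite /qpoly coef_sum; apply: eq_bigr => k _.
  by rewrite !coefZ -!mulrA; congr (_ * _); rewrite mulrC.
apply: (cpxB C); first exact: (cpx_cst C).
apply: (cpx_sum C) => k; apply: (cpxM C); first exact: (cpx_cst C).
apply: (@cpx_circleX R R _ id C); [exact: continuous_cos|exact: continuous_sin].
Qed.

Lemma coef_near_t a r (t : R) j (e : R) : 0 < e ->
  \forall s \near t, normc ((gpoly (Qr Q r) (circle_pt a s))`_j -
                            (gpoly (Qr Q r) (circle_pt a t))`_j) < e.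
Proof.
exact: (ccont_near _ (ccont_coef a r j)).
Qed.

(** * Propagation over the component and evaluation of the Mahler measure *)

Section Main.
Variables (a b : R) (A : set R[i]^o) (r0 : R[i]).
Hypotheses (a0 : 0 < a) (b0 : 0 < b) (cA : connected A) (Ar0 : A r0).
Hypothesis circ : forall r x y, A r -> normc x = a -> normc y = b -> r != gval Q x y.

Lemma gpoly_circle_neq0 r t y : A r -> normc y = b ->
  (gpoly (Qr Q r) (circle_pt a t)).[y] != 0.
Proof.
move=> Ar yb; have y0 : y != 0 by rewrite -normc_gt0 yb.
by rewrite horner_gpoly// mulf_neq0 ?expf_neq0// subr_eq0 circ// normc_circle// ltW.
Qed.

Lemma gpoly_neq0 r t : A r -> gpoly (Qr Q r) (circle_pt a t) != 0.
Proof.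
move=> Ar; have bb : normc b%:C = b by rewrite normc_real// ltW.
by have := gpoly_circle_neq0 t Ar bb; apply: contraNneq => ->; rewrite horner0.
Qed.

(** The circle is parametrized by its angle, so connectedness of the real line stands in for that of
    the circle. *)
Let cR : connected (setT : set R).
Proof. by apply/connected_intervalP => x y _ _ z. Qed.

(** The pair [(r0, t0)] is joined to [(r, t)] in two moves: first the parameter along [A] at a fixed
    angle, then the angle at a fixed parameter. *)
Lemma gpoly_disk_free r t t0 : A r -> disk_free b (gpoly (Qr Q r0) (circle_pt a t0)) ->
  disk_free b (gpoly (Qr Q r) (circle_pt a t)).
Proof.
move=> Ar df.
have {}df : disk_free b (gpoly (Qr Q r) (circle_pt a t0)).
  apply: (@disk_free_connected R R[i]^o (fun r => gpoly (Qr Q r) (circle_pt a t0)) d b b0 _ _ A cA _ r0) => //.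
  - by move=> s; exact: size_gpoly.
  - by move=> s j e; exact: coef_near_r.
  - by move=> s y As; exact: gpoly_circle_neq0.
apply: (@disk_free_connected R R (fun t => gpoly (Qr Q r) (circle_pt a t)) d b b0 _ _ setT cR _ t0) => //.
- by move=> s; exact: size_gpoly.
- by move=> s j e; exact: coef_near_t.
- by move=> s y _; exact: gpoly_circle_neq0.
Qed.

Lemma gpoly_rev_disk_free r t t0 : A r ->
  disk_free b^-1 (rev_poly d (gpoly (Qr Q r0) (circle_pt a t0))) ->
  disk_free b^-1 (rev_poly d (gpoly (Qr Q r) (circle_pt a t))).
Proof.
move=> Ar df.
have {}df : disk_free b^-1 (rev_poly d (gpoly (Qr Q r) (circle_pt a t0))).
  apply: (@rev_disk_free_connected R R[i]^o (fun r => gpoly (Qr Q r) (circle_pt a t0)) d b A b0 _ _ cA _ r0) => //.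
  - by move=> s; exact: size_gpoly.
  - by move=> s j e; exact: coef_near_r.
  - by move=> s y As; exact: gpoly_circle_neq0.
apply: (@rev_disk_free_connected R R (fun t => gpoly (Qr Q r) (circle_pt a t)) d b setT b0 _ _ cR _ t0) => //.
- by move=> s; exact: size_gpoly.
- by move=> s j e; exact: coef_near_t.
- by move=> s y _; exact: gpoly_circle_neq0.
Qed.

Notation mu := (@lebesgue_measure R).

Let circle0 : circle_pt a 0 = a%:C.
Proof. by rewrite /circle_pt cos0 sin0 mulr1. Qed.

(* n is the number of zeros of gpoly in |y| < b; the factor y^v accounts for - v. *)
Lemma iterated_mahler r (f : R -> R[i]) (n : nat) : A r ->
  cpx (fun f : R -> R => continuous f) f -> (forall t, f t != 0) ->
  (forall t, \int[mu]_(s in `[0, 2 * pi])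
      ln (normc (gpoly (Qr Q r) (circle_pt a t)).[circle_pt b s]) =
    2 * pi * (ln (normc (f t)) + n%:R * ln b)) ->
  (2 * pi) ^- 2 * \int[mu]_(t in `[0, 2 * pi]) \int[mu]_(s in `[0, 2 * pi])
    ln (normc (gval (Qr Q r) (circle_pt a t) (circle_pt b s)))
  - (n%:Z - v%:Z)%:~R * ln b =
  (2 * pi)^-1 * \int[mu]_(t in `[0, 2 * pi]) ln (normc (f t)).
Proof.
move=> Ar cf f0 If; have C := continuous_ring_closed R R.
have p2 : 0 < 2 * pi :> R by rewrite mulr_gt0 ?pi_gt0.
have ck (c : R) : continuous (fun _ : R => c) by move=> ?; exact: cvg_cst.
have Ik (c : R) : \int[mu]_(t in `[0, 2 * pi]) c = 2 * pi * c.
  by rewrite Rintegral_cst//= lebesgue_measure_itv/= lte_fin p2/= subr0 mulrC.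
have inner t : \int[mu]_(s in `[0, 2 * pi])
      ln (normc (gval (Qr Q r) (circle_pt a t) (circle_pt b s))) =
    2 * pi * ln (normc (f t)) + 2 * pi * ((n%:R - v%:R) * ln b).
  rewrite -mulrDr mulrBl addrA mulrBr -If -Ik -RintegralB; first last.
  - exact: continuous_integrable.
  - apply: continuous_integrable; apply: continuous_ln_normc.
      exact: (cpx_horner C _ (ccont_circle _)).
    by move=> s; apply: gpoly_circle_neq0 => //; rewrite normc_circle// ltW.
  - exact: measurable_itv.
  apply: eq_Rintegral => s _; rewrite gval_Qr.
  have c0 := circle_neq0 s b0.
  have := gpoly_circle_neq0 t Ar (normc_circle s (ltW b0)).
  rewrite horner_gpoly// mulf_eq0 negb_or => /andP[_ g0].
  rewrite normcM normcX normc_circle ?(ltW b0)// lnM ?posrE ?exprn_gt0 ?normc_gt0//.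
  by rewrite lnXn// -[_ *+ v]mulr_natl; ring.
under eq_Rintegral do rewrite inner.
have clf := continuous_ln_normc cf f0.
rewrite RintegralD; [|exact: measurable_itv| |exact: continuous_integrable]; last first.
  by apply: continuous_integrable => t; apply: cvgMr; exact: clf.
rewrite RintegralZl; [|exact: measurable_itv|exact: continuous_integrable].
rewrite Ik rmorphB /= -!pmulrn.
by move: (lt0r_neq0 p2) (Rintegral _ _ _); move: (2 * pi) => c c0 I; field.
Qed.

Let iterated r := (2 * pi) ^- 2 *
  \int[mu]_(t in `[0, 2 * pi]) \int[mu]_(s in `[0, 2 * pi])
    ln (normc (gval (Qr Q r) (circle_pt a t) (circle_pt b s))).
Let nu r : int := (nzeros (gpoly (Qr Q r) a%:C) b)%:Z -
  pole_order (gpole (Qr Q r)) (gpoly (Qr Q r) a%:C).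

Lemma mahler_inside r : A r -> roots_inside (gtop (Qr Q r0) + gpole (Qr Q r0)) (gpoly (Qr Q r0) a%:C) b ->
  iterated r - (nu r)%:~R * ln b =
  mahler1 a (fun x => (gpoly (Qr Q r) x)`_(gtop (Qr Q r) + gpole (Qr Q r))).
Proof.
rewrite /nu !gtop_Qr !gpole_Qr -/d => Ar.
(* The hypothesis is stated at [x = a], the point of angle 0. *)
rewrite -circle0 => /(roots_inside_disk_free b0 (gpoly_neq0 0 Ar0) (size_gpoly _ _)) df.
have dft t := gpoly_rev_disk_free t Ar df.
(* Propagation at angle 0 gives the root count [d] for [r], and with it the exponent [d - v]. *)
rewrite (@nu_inside _ _ d v b (gpoly_neq0 0 Ar)); last first.
  exact/(roots_inside_disk_free b0 (gpoly_neq0 0 Ar) (size_gpoly _ _)).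
apply: iterated_mahler => //; first exact: ccont_coef.
  (* The leading coefficient is the value at 0 of the reversed polynomial, hence never vanishes on
     the circle. *)
  by move=> t; rewrite -rev_poly0; apply: dft; rewrite normc0 invr_ge0 ltW.
by move=> t; apply: jensen_rev_disk_free => //; exact: size_gpoly.
Qed.

Lemma mahler_outside r : A r -> roots_outside (gpoly (Qr Q r0) a%:C) b ->
  iterated r - (nu r)%:~R * ln b = mahler1 a (fun x => (gpoly (Qr Q r) x)`_0).
Proof.
rewrite /nu !gpole_Qr => Ar.
rewrite -circle0 => /(roots_disk_free (gpoly_neq0 0 Ar0)) df.
have dft t := gpoly_disk_free t Ar df.
rewrite (nu_outside v (ltW b0) (gpoly_neq0 0 Ar)); last first.
  exact/disk_free_roots/dft/ltW.
(* No zero lies in the disk, so the count [n] is 0; the exponent is put in the form [n - v]. *)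
rewrite -[- v%:Z]sub0r.
apply: (@iterated_mahler r (fun t => (gpoly (Qr Q r) (circle_pt a t))`_0) 0) => //.
- exact: ccont_coef.
- by move=> t; rewrite -horner_coef0; apply: dft; rewrite normc0 ltW.
by move=> t; rewrite mul0r addr0 -horner_coef0; apply: jensen_disk_free => //; exact: ltW.
Qed.

End Main.
End Q.
End LaurentGen.

(** * The two-variable Mahler measure as an iterated integral *)

Section Torus.
Variables (R : realType) (P : laurent2 R) (a b : R).
Notation mu := (@lebesgue_measure R).

Let torus (z : R * R) := leval P (circle_pt a z.1) (circle_pt b z.2).

(** Instantiated below with both continuity and measurability, which [Rintegral_square] requires. *)
Let cpx_torus (S : (R * R -> R) -> Prop) : fun_ring_closed S ->
  S (fun z => cos z.1) -> S (fun z => sin z.1) ->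
  S (fun z => cos z.2) -> S (fun z => sin z.2) -> cpx S torus.
Proof.
move=> C c1 s1 c2 s2; apply: (cpx_sum C) => k.
apply: (cpxM C); last exact: (cpx_circleX C c2 s2).
by apply: (cpxM C); [exact: (cpx_cst C)|exact: (cpx_circleX C c1 s1)].
Qed.

(** Nonvanishing on the torus makes the integrand continuous. Both orders are recorded because the
    inner variable is [y] in one half of the theorem and [x] in the other. *)
Lemma mahler2_iterated : (forall t s, leval P (circle_pt a t) (circle_pt b s) != 0) ->
  mahler2 a b (leval P) = (2 * pi) ^- 2 *
    \int[mu]_(t in `[0, 2 * pi]) \int[mu]_(s in `[0, 2 * pi])
      ln (normc (leval P (circle_pt a t) (circle_pt b s))) /\
  mahler2 a b (leval P) = (2 * pi) ^- 2 *
    \int[mu]_(s in `[0, 2 * pi]) \int[mu]_(t in `[0, 2 * pi])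
      ln (normc (leval P (circle_pt a t) (circle_pt b s))).
Proof.
move=> P0.
have mc : measurable_fun setT (@cos R).
  by apply: continuous_measurable_fun; exact: continuous_cos.
have ms : measurable_fun setT (@sin R).
  by apply: continuous_measurable_fun; exact: continuous_sin.
have ct : continuous (fun z => ln (normc (torus z))).
  apply: continuous_ln_normc; last by move=> z; exact: P0.
  apply: cpx_torus; first exact: continuous_ring_closed.
  - by move=> z; apply: continuous_comp; [exact: cvg_fst|exact: continuous_cos].
  - by move=> z; apply: continuous_comp; [exact: cvg_fst|exact: continuous_sin].
  - by move=> z; apply: continuous_comp; [exact: cvg_snd|exact: continuous_cos].
  - by move=> z; apply: continuous_comp; [exact: cvg_snd|exact: continuous_sin].
(* Measurability for the product sigma-algebra is derived from the two projections. *)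
have mt : measurable_fun setT (fun z => ln (normc (torus z))).
  apply: measurable_ln_normc; apply: cpx_torus; first exact: measurable_ring_closed.
  - exact: (measurableT_comp mc measurable_fst).
  - exact: (measurableT_comp ms measurable_fst).
  - exact: (measurableT_comp mc measurable_snd).
  - exact: (measurableT_comp ms measurable_snd).
have [h1 h2] := Rintegral_square 0 (2 * pi) ct mt.
by split; rewrite /mahler2; [rewrite -h1|rewrite -h2].
Qed.

End Torus.

(** * Both halves of the theorem as instances of the uniform treatment *)

Theorem theorem1p3 (R : realType) (Q : laurent2 R) (a b : R) (r0 : R[i])
  (Q00 : Q (0, 0) = 0) (a0 : 0 < a) (b0 : 0 < b)
  (r0R : ~ Rab Q a b r0) (Vbnd : bounded_set (Vab Q a b r0)) :
  (let p := ypoly (Qr Q r0) a%:C in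
   let d := ydeg (Qr Q r0) in
   roots_inside d p b \/ roots_outside p b ->
   forall r, Vab Q a b r0 r ->
     (roots_inside d p b ->
        mahler2 a b (leval (Qr Q r)) - (nu2 a b (Qr Q r))%:~R * ln b
        = mahler1 a (QFy (Qr Q r))) /\
     (roots_outside p b ->
        mahler2 a b (leval (Qr Q r)) - (nu2 a b (Qr Q r))%:~R * ln b
        = mahler1 a (Qfy (Qr Q r)))) /\
  (let p := xpoly (Qr Q r0) b%:C in
   let d := xdeg (Qr Q r0) in
   roots_inside d p a \/ roots_outside p a ->
   forall r, Vab Q a b r0 r ->
     (roots_inside d p a ->
        mahler2 a b (leval (Qr Q r)) - (nu1 a b (Qr Q r))%:~R * ln a
        = mahler1 b (QFx (Qr Q r))) /\
     (roots_outside p a ->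
        mahler2 a b (leval (Qr Q r)) - (nu1 a b (Qr Q r))%:~R * ln a
        = mahler1 b (Qfx (Qr Q r)))).
Proof.
have cV : connected (Vab Q a b r0) by exact: component_connected.
have Vr0 : Vab Q a b r0 r0 by exact: connected_component_refl.
(* The component lies in the complement of the image of the torus. *)
have circ r x y : Vab Q a b r0 r -> normc x = a -> normc y = b -> r != leval Q x y.
  move=> /connected_component_sub Vr xa yb; apply/eqP => rQ.
  by apply: Vr; exists x, y.
have lE r x y : leval (Qr Q r) x y = r - leval Q x y.
  exact: (@gval_Qr R fst snd).
(* Evaluation with the variables exchanged agrees with [leval] after commuting the two powers; this
   serves the second half. *)
have gE P x y : gval snd fst P y x = leval P x y.
  by apply: eq_bigr => k _; rewrite mulrAC.
have mE r : Vab Q a b r0 r -> forall t s, leval (Qr Q r) (circle_pt a t) (circle_pt b s) != 0.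
  by move=> Vr t s; rewrite lE subr_eq0 circ ?normc_circle ?ltW.
split=> [p d _ r Vr|p d _ r Vr].
- have [-> _] := mahler2_iterated (mE r Vr); split.
    exact: (@mahler_inside R fst snd erefl erefl Q Q00 a b _ r0 a0 b0 cV Vr0 circ r Vr).
  exact: (@mahler_outside R fst snd erefl erefl Q Q00 a b _ r0 a0 b0 cV Vr0 circ r Vr).
(* Here the inner integral runs over [x], and the radii [a] and [b] exchange their roles. *)
- have [_ ->] := mahler2_iterated (mE r Vr).
  have circ' r' x y : Vab Q a b r0 r' -> normc x = b -> normc y = a ->
      r' != gval snd fst Q x y by move=> *; rewrite gE circ.
  under eq_Rintegral do under eq_Rintegral do rewrite -gE.
  split.
    exact: (@mahler_inside R snd fst erefl erefl Q Q00 b a _ r0 b0 a0 cV Vr0 circ' r Vr).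
  exact: (@mahler_outside R snd fst erefl erefl Q Q00 b a _ r0 b0 a0 cV Vr0 circ' r Vr).
Qed.
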